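(* Let $G$ be a graph of order $n$ with clique number $\omega$. If $u$ and $v$ are two vertices of $G$ of degree at least $n-\omega+1$, then there exists a path in $G$ with endpoints $u$ and $v$ containing all vertices of $G$ of degree at least $n-\omega+1$, unless $\frac{n+2}{2}\le \omega\le n-1$ and either $G\cong K_{n-\omega+1}\vee (K_{2\omega-n-1}\cup \overline{K_{n-\omega}})$ or $G\in\mathcal{H}(n,\omega)$.
   Context: All graphs are finite, undirected, without loops or multiple edges. The clique number of $G$ is the maximum cardinality of a clique in $G$. $K_m$ denotes the complete graph on $m$ vertices, $\overline{K_m}$ the edgeless graph on $m$ vertices, and $K_{1,m}$ the star with $m$ leaves. For graphs $G,H$, $G\cup H$ is their disjoint union and $G\vee H$ (the join) is obtained from $G\cup H$ by adding all edges between $V(G)$ and $V(H)$. For integers $n,\omega$ with $\frac{n+2}{2}\le\omega\le n-1$, let $H_1=K_2\vee(K_{\omega-2}\cup K_1)$ and $H_2=K_{1,n-\omega-1}$; let $x$ be the vertex of degree two in $H_1$ (the vertex of the $K_1$) and $y$ the center vertex of $H_2$ (the vertex of degree $n-\omega-1$). Let $H_1xyH_2$ be the graph obtained from $H_1\cup H_2$ by identifying $x$ and $y$ (a graph on $n$ vertices). Then $\mathcal{H}(n,\omega)$ is the set of graphs (up to isomorphism) that contain $H_1xyH_2$ as a spanning subgraph and are spanning subgraphs of $K_2\vee(K_{\omega-2}\cup K_{n-\omega})$. *)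

(* Defs.v *)
From mathcomp Require Import all_boot.

Set Implicit Arguments.
Unset Strict Implicit.
Unset Printing Implicit Defensive.

Record sgraph := SGraph {
  vertex :> finType;
  adj : rel vertex;
  adj_sym : symmetric adj;
  adj_irrefl : irreflexive adj }.
Arguments adj {s} x y.

Definition degree (G : sgraph) (x : G) : nat := #|[set y | adj x y]|.

Definition clique (G : sgraph) (A : {set G}) : bool :=
  [forall x in A, forall y in A, (x != y) ==> adj x y].

Definition clique_number (G : sgraph) : nat :=
  \max_(A : {set G} | clique A) #|A|.

(* The vertices of the path are [u :: p], in order. *)
Definition path_between (G : sgraph) (u v : G) (p : seq G) : bool :=
  [&& path adj u p, last u p == v & uniq (u :: p)].

Definition isomorphic (G H : sgraph) : Prop :=
  exists2 f : G -> H, bijective f & forall x y, adj (f x) (f y) = adj x y.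

(* [G] is, up to isomorphism, a spanning subgraph of [H]. *)
Definition spanning_subgraph (G H : sgraph) : Prop :=
  exists2 f : G -> H, bijective f & forall x y, adj x y -> adj (f x) (f y).

Section Complete.
Variable m : nat.
Definition complete_adj : rel 'I_m := fun i j => i != j.
Fact complete_adj_sym : symmetric complete_adj.
Proof. by move=> i j; rewrite /complete_adj eq_sym. Qed.
Fact complete_adj_irrefl : irreflexive complete_adj.
Proof. by move=> i; rewrite /complete_adj eqxx. Qed.
Definition complete : sgraph := SGraph complete_adj_sym complete_adj_irrefl.

Definition edgeless_adj : rel 'I_m := fun _ _ => false.
Fact edgeless_adj_sym : symmetric edgeless_adj.
Proof. by []. Qed.
Fact edgeless_adj_irrefl : irreflexive edgeless_adj.
Proof. by []. Qed.
Definition edgeless : sgraph := SGraph edgeless_adj_sym edgeless_adj_irrefl.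
End Complete.

Section UnionJoin.
Variables G H : sgraph.

(* [b] tells whether the edges between the two sides are present. *)
Definition sum_adj (b : bool) : rel (G + H)%type := fun s t =>
  match s, t with
  | inl x, inl y => adj x y
  | inr x, inr y => adj x y
  | _, _ => b
  end.
Fact sum_adj_sym b : symmetric (sum_adj b).
Proof. by case=> x [] y //=; rewrite adj_sym. Qed.
Fact sum_adj_irrefl b : irreflexive (sum_adj b).
Proof. by case=> x /=; rewrite adj_irrefl. Qed.

Definition graph_union : sgraph :=
  SGraph (sum_adj_sym false) (sum_adj_irrefl false).
Definition graph_join : sgraph :=
  SGraph (sum_adj_sym true) (sum_adj_irrefl true).
End UnionJoin.

(* [identify x y] is [G] union [H] with [x] and [y] identified; the merged
   vertex is represented by [inl x], and [y] is dropped from [H]. *)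
Section Identify.
Variables (G H : sgraph) (x : G) (y : H).

Definition identify_adj : rel (G + {z : H | z != y})%type := fun s t =>
  match s, t with
  | inl a, inl b => adj a b
  | inr c, inr d => adj (val c) (val d)
  | inl a, inr d => (a == x) && adj y (val d)
  | inr c, inl b => (b == x) && adj (val c) y
  end.
Fact identify_adj_sym : symmetric identify_adj.
Proof. by case=> a [] b //=; rewrite adj_sym. Qed.
Fact identify_adj_irrefl : irreflexive identify_adj.
Proof. by case=> a /=; rewrite adj_irrefl. Qed.
Definition identify : sgraph := SGraph identify_adj_sym identify_adj_irrefl.
End Identify.

Definition star (m : nat) : sgraph := graph_join (complete 1) (edgeless m).
Definition star_center (m : nat) : star m := inl ord0.

Definition H1 (w : nat) : sgraph :=
  graph_join (complete 2) (graph_union (complete (w - 2)) (complete 1)).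
Definition H1_x (w : nat) : H1 w := inr (inr ord0).

Definition H2 (n w : nat) : sgraph := star (n - w - 1).
Definition H2_y (n w : nat) : H2 n w := star_center (n - w - 1).

Definition H1xyH2 (n w : nat) : sgraph := identify (H1_x w) (H2_y n w).

(* Meaningful for [(n + 2) / 2 <= w <= n - 1], where no natural-number
   subtraction below or in [H1], [H2] is truncated. *)
Definition in_calH (n w : nat) (G : sgraph) : Prop :=
  spanning_subgraph (H1xyH2 n w) G /\
  spanning_subgraph G
    (graph_join (complete 2)
       (graph_union (complete (w - 2)) (complete (n - w)))).

(* Main.v *)
(** Let K be a maximum clique and r = n - w, so that the vertices to be covered
    (the heavy ones) are those of degree greater than r. A Bondy-Chvatal closure
    works relative to a vertex set W: if the degrees into W of two nonadjacent
    vertices of W sum to more than |W|, adding the edge between them creates no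
    new pair of endpoints joined by a path inside W through a prescribed set.
    In the closure with W = V either the heavy vertices form a clique, and we
    are done, or r + 2 <= w and every heavy vertex outside K has degree exactly
    r + 1 and is adjacent precisely to the set A of those vertices of K that
    have a neighbour outside K, besides its neighbours outside K. In the second
    case |A| = 2 gives the family H(n, w); |A| = r + 1 with all r outer vertices
    heavy gives the join graph. Otherwise replace K \ A by a single vertex b:
    two further closures, on smaller vertex sets, turn b, A and the heavy outer
    vertices into a clique, and the rest of K \ A can be inserted into a path
    next to b. *)
Require Import Defs.
From mathcomp Require Import all_boot.
From mathcomp Require Import zify.

Set Implicit Arguments.
Unset Strict Implicit.
Unset Printing Implicit Defensive.

(** * Consecutive pairs in a sequence *)

Lemma not_pathP (T : Type) (R : rel T) x p :
  ~~ path R x p ->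
  exists t1 q q' t2, x :: p = t1 ++ q :: q' :: t2 /\ ~~ R q q'.
Proof.
elim: p x => //= y p IHp x; rewrite negb_and => /orP[nR | /IHp].
  by exists [::], x, y, p.
by case=> t1 [q [q' [t2 [-> nR]]]]; exists (x :: t1), q, q', t2.
Qed.

(** Counting [Q] one position later than [P], each consecutive pair contributes at most 1; the extra
    1 is for [P] at the last entry. *)
Lemma count_path_exclusive (T : Type) (P Q : pred T) x p :
  path (fun a b => ~~ (P a && Q b)) x p ->
  count P (x :: p) + count Q p <= (size p).+1.
Proof.
elim: p x => [|y p IHp] x /=; first by case: (P x).
case/andP=> nPQ /IHp /=; move: nPQ.
by case: (P x); case: (P y); case: (Q y) => //=; lia.
Qed.

(** * Paths through prescribed vertices, and degree closures *)

Section Paths.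
Variable V : finType.
Implicit Types (e : rel V) (W S X : {set V}) (u v x y z : V) (s : seq V).

(** The list includes the first vertex, so that paths can be cut, reversed and concatenated
    symmetrically. *)
Definition upath e u v s :=
  if s is x :: p then [&& x == u, path e x p, last x p == v & uniq s]
  else false.

Lemma upath_uniq e u v s : upath e u v s -> uniq s.
Proof. by case: s => // x p /and4P[]. Qed.

Lemma upath1 e u : upath e u u [:: u].
Proof. by rewrite /= !eqxx. Qed.

Lemma upath_cat e u x y v s1 s2 :
  upath e u x s1 -> upath e y v s2 -> e x y -> uniq (s1 ++ s2) ->
  upath e u v (s1 ++ s2).
Proof.
case: s1 s2 => // a p [|b q] //= /and4P[-> ep /eqP la _].
case/and4P=> /eqP -> eq /eqP lb _ exy ->.
by rewrite cat_path ep last_cat la /= exy eq lb eqxx.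
Qed.

Lemma upath_cut e u v s1 q q' s2 :
  upath e u v (s1 ++ q :: q' :: s2) ->
  [/\ upath e u q (rcons s1 q), upath e q' v (q' :: s2) & e q q'].
Proof.
move=> us; have := upath_uniq us.
rewrite -cat_rcons cat_uniq => /and3P[us1 _ us2].
case: s1 us1 us => [|a p] us1 /=.
  by case/and4P=> -> /andP[-> ->] -> _; move: us2 => /= ->; rewrite !eqxx.
case/and4P=> -> + + _; rewrite cat_path last_cat /= => /and4P[ep eq -> ->] ->.
by move: us1 us2 => /= -> ->; rewrite rcons_path last_rcons !eqxx ep eq.
Qed.

Lemma upath_rev e u v s : symmetric e -> upath e u v s -> upath e v u (rev s).
Proof.
move=> symE; case: s => // x p /and4P[/eqP <- ep /eqP <- us].
move: ep us; rewrite -rev_uniq lastI rev_rcons => ep us.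
rewrite /upath us eqxx rev_path /=.
rewrite (eq_path (e' := e)) ?ep /= ?andbT; last by move=> a b; apply: symE.
by case: p {ep us} => //= y p; rewrite rev_cons last_rcons.
Qed.

Lemma upath_sub e e' u v s :
  {in s &, subrel e e'} -> upath e u v s -> upath e' u v s.
Proof.
case: s => // x p ee' /and4P[xu ep lp us]; apply/and4P; split=> //.
by apply: sub_in_path (allss (x :: p)) ep.
Qed.

(** The sets [W] and [S] are kept apart because rerouting a path may pick up a vertex of [W] outside
    [S]. *)
Definition linked e W S u v :=
  exists s, [/\ upath e u v s, {subset s <= W} & {subset S <= s}].

Lemma linkedS e W W' S S' u v :
  W \subset W' -> S' \subset S -> linked e W S u v -> linked e W' S' u v.
Proof.
move=> /subsetP sW /subsetP sS [s [us sWs Ss]]; exists s.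
by split=> // z => [/sWs/sW | /sS/Ss].
Qed.

Lemma linked_clique e W S u v :
  S \subset W -> {in S &, forall x y, x != y -> e x y} ->
  u \in S -> v \in S -> u != v -> linked e W S u v.
Proof.
move=> /subsetP sSW cS uS vS uv.
pose s := u :: rcons (enum (S :\ u :\ v)) v.
have memE : s =i S.
  move=> z; rewrite inE mem_rcons inE mem_enum !inE.
  have [->|] := eqVneq z u; first by rewrite uS.
  by have [->|] := eqVneq z v; rewrite ?vS.
have us : uniq s.
  rewrite /s /= mem_rcons inE negb_or uv rcons_uniq enum_uniq.
  by rewrite !mem_enum !inE !eqxx /= andbF.
exists s; split=> [|z|z]; last by rewrite memE.
  apply/and4P; split=> //; last by rewrite last_rcons.
  have : {subset s <= S} by move=> z; rewrite memE.
  move: us; rewrite /s; move: (rcons (enum _) v) => q;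
    elim: q (u) => //= y p IHp x.
  case/andP; rewrite inE negb_or => /andP[xy _] up sS.
  rewrite cS ?sS ?mem_head ?inE ?eqxx ?orbT //=.
  by apply: IHp => // z zp; apply: sS; rewrite inE zp orbT.
by rewrite memE => /sSW.
Qed.

(** Since [c] is adjacent to [b] and to every other neighbour of [b], it fits between [b] and the
    next vertex of the path, or the previous one if [b] is last. As [u != v], one of the two
    exists. *)
Lemma linked_insert e W S u v b c :
  symmetric e -> u != v -> b \in S -> e b c ->
  (forall z, e b z -> z != c -> e c z) ->
  linked e W S u v -> linked e (c |: W) (c |: S) u v.
Proof.
move=> symE uv bS ebc bcN [s [us sW Ss]].
case cs: (c \in s).
  exists s; split=> // z; first by move/sW; rewrite inE orbC => ->.
  by rewrite !inE => /orP[/eqP -> | /Ss].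
suff [s' us' ps'] : exists2 s', upath e u v s' & perm_eq s' (c :: s).
  exists s'; split=> // z; rewrite (perm_mem ps') !inE.
    by case/orP=> [-> | /sW ->] //; rewrite orbT.
  by case/orP=> [-> | /Ss ->] //; rewrite orbT.
have uc : uniq (c :: s) by rewrite /= cs (upath_uniq us).
have bs : b \in s := Ss b bS.
case/splitPr: bs us uc cs {sW Ss} => t1 [|z t2] us uc cs.
  case/lastP: t1 us uc cs => [|t1 z] us uc cs.
    by case/and4P: us uv => /eqP <- _ /eqP <-; rewrite eqxx.
  have perm : perm_eq (rcons t1 z ++ [:: c] ++ [:: b])
                      (c :: rcons t1 z ++ [:: b]).
    by apply/permP=> a; rewrite /= !count_cat /=; clear; lia.
  have uu := perm_uniq perm; rewrite uc in uu.
  exists (rcons t1 z ++ [:: c] ++ [:: b]) => //.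
  move: us; rewrite cat_rcons => /upath_cut[us ub ezb].
  have zc : z != c.
    by apply: contraFneq cs => <-; rewrite mem_cat mem_rcons mem_head.
  apply: (upath_cat us _ (y := c)) => //; last by rewrite symE bcN // symE.
  apply: (upath_cat (upath1 e c) ub); rewrite 1?symE //.
  by move: uu; rewrite cat_uniq => /and3P[].
have perm : perm_eq (rcons t1 b ++ [:: c] ++ z :: t2) (c :: t1 ++ b :: z :: t2).
  by apply/permP=> a; rewrite -cats1 /= !count_cat /=; clear; lia.
have uu := perm_uniq perm; rewrite uc in uu.
exists (rcons t1 b ++ [:: c] ++ z :: t2) => //.
have [us1 us2 ebz] := upath_cut us.
have zc : z != c.
  by apply: contraFneq cs => <-; rewrite mem_cat !inE eqxx !orbT.
apply: (upath_cat us1 _ ebc) => //.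
apply: (upath_cat (upath1 e c) us2); first exact: bcN.
by move: uu; rewrite cat_uniq => /and3P[].
Qed.

Lemma linked_insert_set e W S u v b (C : {set V}) :
  symmetric e -> u != v -> b \in S -> {in C, forall c, e b c} ->
  {in C, forall c z, e b z -> z != c -> e c z} ->
  linked e W S u v -> linked e (C :|: W) (C :|: S) u v.
Proof.
move=> symE uv bS bC bN Ws; rewrite -[C]set_enum.
have: {subset enum C <= C} by move=> c; rewrite mem_enum.
elim: (enum C) => [|c cs IHcs] sC.
  by apply: linkedS Ws; apply/subsetP=> z; rewrite !inE.
have cC : c \in C by apply: sC; apply: mem_head.
have /IHcs {}IHcs : {subset cs <= C}.
  by move=> z zcs; apply: sC; rewrite inE zcs orbT.
have bS' : b \in [set x in cs] :|: S by rewrite inE bS orbT.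
have := linked_insert symE uv bS' (bC c cC) (bN c cC) IHcs.
by apply: linkedS; apply/subsetP=> z; rewrite !inE orbA.
Qed.

Definition nbr e W x := [set z in W | e x z].

Lemma in_nbr e W x z : (z \in nbr e W x) = (z \in W) && e x z.
Proof. by rewrite inE. Qed.

(** Ore's argument. The two paths can be merged by the edge [x y], by a common neighbour off the
    paths, or by reversing the end of [s1] or the start of [s2]. If all of these fail, the
    neighbours of [x] and [y] in [W] number at most [#|W|]. *)
Lemma upath_bridge e W u v x y s1 s2 :
  symmetric e -> irreflexive e ->
  upath e u x s1 -> upath e y v s2 -> uniq (s1 ++ s2) ->
  {subset s1 ++ s2 <= W} -> #|W| < #|nbr e W x| + #|nbr e W y| ->
  linked e W [set z in s1 ++ s2] u v.
Proof.
move=> symE irrE us1 us2 us sW degW.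
have permP' s : upath e u v s -> perm_eq s (s1 ++ s2) ->
    linked e W [set z in s1 ++ s2] u v.
  by move=> ups ps; exists s; split=> // z;
    rewrite ?inE (perm_mem ps) // => /sW.
case exy: (e x y); first by apply: permP' (perm_refl _);
  apply: upath_cat exy us.
case: (pickP [pred z in W | [&& z \notin s1 ++ s2, e x z & e y z]]).
  move=> z /= /and4P[zW zs exz eyz].
  have perm : perm_eq (s1 ++ [:: z] ++ s2) (z :: s1 ++ s2).
    by apply/permP=> a; rewrite /= !count_cat /=; clear; lia.
  have uu := perm_uniq perm; rewrite /= zs us /= in uu.
  exists (s1 ++ [:: z] ++ s2); split=> [|a|a].
  - apply: (upath_cat us1 _ exz) => //.
    apply: (upath_cat (upath1 e z) us2); first by rewrite symE.
    by move: uu; rewrite cat_uniq => /and3P[].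
  - by rewrite (perm_mem perm) inE => /predU1P[-> | /sW].
  - by rewrite inE (perm_mem perm) inE orbC => ->.
move=> noz.
have us1r := upath_rev symE us1.
have [l' def_l] : exists l', rev s1 = x :: l'.
  by case: (rev s1) us1r => // a l' /andP[/eqP -> _]; exists l'.
have [r' def_r] : exists r', s2 = y :: r'.
  by case: (s2) us2 => // a r' /andP[/eqP -> _]; exists r'.
have def_s1 : s1 = rev (x :: l') by rewrite -def_l revK.
(* Along [s1] read back from [x]: if [q] is adjacent to [y] and its successor [q'] to [x], the route
   is u..q', x..q, y..v. *)
have [pl|] :=
    boolP (path (fun a b => ~~ (e y a && e x b)) x l'); last first.
  move=> npath; have [t1 [q [q' [t2 [def_t]]]]] := not_pathP npath;
    rewrite negbK => /andP[eyq exq'].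
  move: us1r; rewrite def_l def_t => /upath_cut[ut1 ut2 _].
  have perm : perm_eq (rev (q' :: t2) ++ rcons t1 q ++ s2) (s1 ++ s2).
    apply/permP=> a; rewrite def_s1 def_t -cats1 !count_cat !count_rev.
    by rewrite !count_cat /=; clear; lia.
  have uu := perm_uniq perm; rewrite us in uu.
  apply: permP' perm; apply: (upath_cat (upath_rev symE ut2) _ _ uu).
    apply: (upath_cat ut1 us2); first by rewrite symE.
    by move: uu; rewrite cat_uniq => /and3P[].
  by rewrite symE.
(* Symmetrically along [s2]: with [q] adjacent to [x] and [q'] to [y], the route is u..x, q..y,
   q'..v. *)
have [pr|] :=
    boolP (path (fun a b => ~~ (e x a && e y b)) y r'); last first.
  move=> npath; have [t1 [q [q' [t2 [def_t]]]]] := not_pathP npath;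
    rewrite negbK => /andP[exq eyq'].
  have us2c := us2; rewrite def_r def_t in us2c;
    have [ut1 ut2 _] := upath_cut us2c.
  have perm : perm_eq (s1 ++ rev (rcons t1 q) ++ q' :: t2) (s1 ++ s2).
    apply/permP=> a; rewrite def_r def_t -cats1 !count_cat !count_rev.
    by rewrite !count_cat /=; clear; lia.
  have uu := perm_uniq perm; rewrite us in uu.
  apply: (permP' _ _ perm); apply: (upath_cat us1 _ exq uu).
  apply: (upath_cat (upath_rev symE ut1) ut2 eyq').
  by move: uu; rewrite cat_uniq => /and3P[].
(* The counts omit [x] for [e x] and [y] for [e y], which irreflexivity makes harmless, so the two
   degrees into the paths sum to at most the number of path vertices. Off the paths the
   neighbourhoods are disjoint. *)
exfalso; have cl := count_path_exclusive pl; have cr := count_path_exclusive pr.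
have nbr_in a : #|nbr e W a :&: [set z in s1 ++ s2]| <= count (e a) (s1 ++ s2).
  rewrite -size_filter; apply: leq_trans (card_size _).
  apply: subset_leq_card; apply/subsetP=> z.
  by rewrite !inE mem_filter => /andP[/andP[_ ->]].
have nbr_out : #|nbr e W x :\: [set z in s1 ++ s2]|
    + #|nbr e W y :\: [set z in s1 ++ s2]| <= #|W :\: [set z in s1 ++ s2]|.
  rewrite -cardsUI -[leqRHS]addn0; apply: leq_add.
    apply: subset_leq_card; apply/subsetP=> z; rewrite !inE.
    by case/orP=> /and3P[-> -> _].
  rewrite leqn0 cards_eq0 -subset0; apply/subsetP=> z; rewrite !inE.
  have := noz z; rewrite /= mem_cat.
  by case: (z \in W); case: (_ || _); case: (e x z); case: (e y z).
have cardW : #|W :\: [set z in s1 ++ s2]| + size (s1 ++ s2) = #|W|.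
  rewrite -(card_uniqP us) -(cardsE (mem (s1 ++ s2))) cardsDS ?subnK //.
    by apply/subset_leq_card/subsetP=> z; rewrite inE => /sW.
  by apply/subsetP=> z; rewrite inE => /sW.
have dx := cardsID [set z in s1 ++ s2] (nbr e W x).
have dy := cardsID [set z in s1 ++ s2] (nbr e W y).
move: (nbr_in x) (nbr_in y) degW nbr_out cardW dx dy.
move: #|W :\: _| #|nbr e W x :\: _| #|nbr e W y :\: _|.
move: #|nbr e W x :&: _| #|nbr e W y :&: _| #|W| #|nbr e W x| #|nbr e W y|.
rewrite !count_cat size_cat def_s1 def_r !count_rev size_rev.
by move: cl cr; rewrite /= !irrE symE exy; clear; lia.
Qed.

Definition add_edge e x y : rel V :=
  fun a b => [|| e a b, (a == x) && (b == y) | (a == y) && (b == x)].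

Lemma add_edge_sym e x y : symmetric e -> symmetric (add_edge e x y).
Proof.
by move=> symE a b; rewrite /add_edge symE; congr (_ || _);
  rewrite orbC andbC [X in _ || X]andbC.
Qed.

(** A simple path uses the new edge at most once. Removing it leaves two paths of [e], which
    [upath_bridge] joins again without losing a vertex. *)
Lemma linked_add_edge e W S u v x y :
  symmetric e -> irreflexive e -> #|W| < #|nbr e W x| + #|nbr e W y| ->
  linked (add_edge e x y) W S u v -> linked e W S u v.
Proof.
move=> symE irrE degW [s [us sW Ss]].
case: s us sW Ss => // a p us sW Ss.
have [ep|] := boolP (path e a p).
  by exists (a :: p); split=> //; case/and4P: us => au _ la ua; apply/and4P;
    split.
move=> npath; have [t1 [q [q' [t2 [def_t nqq']]]]] := not_pathP npath.
rewrite def_t in us sW Ss; have [us1 us2 eqq'] := upath_cut us.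
have uu := upath_uniq us; rewrite -cat_rcons in uu sW Ss.
have degW' : #|W| < #|nbr e W q| + #|nbr e W q'|.
  move: eqq'; rewrite /add_edge (negPf nqq') /=.
  by case/orP=> /andP[/eqP -> /eqP ->] //; rewrite addnC.
have xy_cut c d : add_edge e x y c d -> e c d \/ [set c; d] = [set q; q'].
  move: eqq'; rewrite /add_edge (negPf nqq') /= => qxy.
  case/or3P=> [|h|h]; first by left.
    right; case/andP: h => /eqP -> /eqP ->.
    by case/orP: qxy => /andP[/eqP -> /eqP ->] //; rewrite setUC.
  right; case/andP: h => /eqP -> /eqP ->.
  by case/orP: qxy => /andP[/eqP -> /eqP ->] //; rewrite setUC.
(* Each half misses one of [q], [q'], the ends of the new edge, so all its edges are in [e]. *)
have sub1 (t : seq V) : ~~ ((q \in t) && (q' \in t)) ->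
    {in t &, subrel (add_edge e x y) e}.
  move=> nt c d ct dt /xy_cut[] // cd; case/negP: nt.
  have inE' z : z \in [set q; q'] -> z \in t.
    by rewrite -cd !inE => /orP[] /eqP ->.
  by rewrite !inE' // !inE eqxx ?orbT.
move: (uu); rewrite cat_uniq => /and3P[_ /hasPn dis _].
have := upath_bridge symE irrE _ _ uu sW degW'.
move=> /(_ u v) br; apply: linkedS (br _ _) => //.
- by apply/subsetP=> z /Ss; rewrite inE.
- apply: upath_sub us1; apply: sub1; rewrite negb_and; apply/orP; right.
  by apply: dis; apply: mem_head.
apply: upath_sub us2; apply: sub1; rewrite negb_and; apply/orP; left.
by apply/negP=> /dis /=; rewrite mem_rcons mem_head.
Qed.

Lemma degree_closure e W :
  symmetric e -> irreflexive e -> exists e' : rel V,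
    [/\ subrel e e', symmetric e', irreflexive e',
        {in W &, forall x y, x != y -> #|W| < #|nbr e' W x| + #|nbr e' W y| ->
          e' x y} &
        forall S u v, linked e' W S u v -> linked e W S u v].
Proof.
(* Edges are added one at a time; the induction is on the number of nonadjacent ordered pairs. *)
move: {2}_.+1 (ltnSn #|[set p : V * V | ~~ e p.1 p.2]|) => m.
elim: m e => // m IHm e; rewrite ltnS => lem symE irrE.
case: (pickP [pred p : V * V | [&& p.1 \in W, p.2 \in W, p.1 != p.2,
    ~~ e p.1 p.2 & #|W| < #|nbr e W p.1| + #|nbr e W p.2|]]) => [[x y]|no].
  case/and5P=> /= xW yW xy nexy degW.
  have ee1 : subrel e (add_edge e x y) by move=> a b; rewrite /add_edge => ->.
  have [|||e' [s1 symE' irrE' c1 l1]] := IHm (add_edge e x y).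
  - apply: leq_trans lem; apply: proper_card; apply/properP; split.
      by apply/subsetP=> p; rewrite !inE; apply: contra => /ee1.
    by exists (x, y); rewrite !inE //= /add_edge !eqxx orbT.
  - exact: add_edge_sym.
  - move=> a; rewrite /add_edge irrE /=; apply/negP.
    by case/orP=> /andP[/eqP -> /eqP ab]; move: xy; rewrite ab eqxx.
  exists e'; split=> // [a b /ee1/s1 | S u v /l1] //.
  exact: linked_add_edge.
exists e; split=> // x y xW yW xy degW; apply/negPn/negP=> nexy.
by have := no (x, y); rewrite /= xW yW xy nexy degW.
Qed.

Lemma nbr_sub e e' W W' x :
  subrel e e' -> W \subset W' -> #|nbr e W x| <= #|nbr e' W' x|.
Proof.
move=> ee' /subsetP WW'; apply/subset_leq_card/subsetP=> z; rewrite !inE.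
by case/andP=> /WW' -> /ee'.
Qed.

(* In the closure on W the set T becomes a clique, its degrees exceeding |W|/2;
   this makes the closure on the smaller set b |: (A :|: T) join b to T. *)
Lemma linked_core e (A T W : {set V}) b r u v :
  symmetric e -> irreflexive e ->
  b \notin A -> b \notin T -> [disjoint A & T] -> 2 < #|A| ->
  {in b |: A &, forall x y, x != y -> e x y} ->
  {in A & T, forall x y, e x y} ->
  b |: (A :|: T) \subset W -> #|W| <= 2 * r + 1 ->
  {in T, forall y, r < #|nbr e W y|} ->
  u \in b |: (A :|: T) -> v \in b |: (A :|: T) -> u != v ->
  linked e W (b |: (A :|: T)) u v.
Proof.
move=> symE irrE bA bT dAT a3 cA cAT sXW W2r degT uX vX uv.
have [e1 [s1 sym1 irr1 c1 l1]] := degree_closure W symE irrE.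
have clT : {in T &, forall x y, x != y -> e1 x y}.
  have sTW z : z \in T -> z \in W.
    by move=> zT; apply: (subsetP sXW); rewrite !inE zT !orbT.
  move=> x y xT yT xy; apply: c1; rewrite ?sTW //.
  have := nbr_sub x s1 (subxx W); have := nbr_sub y s1 (subxx W).
  by have := degT x xT; have := degT y yT; move: W2r; clear; lia.
apply/l1/(linkedS sXW (subxx _)).
have [e2 [s2 sym2 irr2 c2 l2]] := degree_closure (b |: (A :|: T)) sym1 irr1.
(* The degrees of [b] and [y] are at least |A| and |A| + |T| - 1; their sum exceeds the size 1 + |A|
   + |T| of the set exactly because |A| > 2. *)
have bT2 : {in T, forall y, e2 b y}.
  move=> y yT; apply: c2; rewrite ?inE ?eqxx ?yT ?orbT //.
    by apply: contraNneq bT => ->.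
  have cX : #|b |: (A :|: T)| = 1 + #|A| + #|T|.
    rewrite cardsU1 !inE negb_or bA bT /= -addnA; congr (_ + _).
    by apply/eqP; rewrite -(leq_card_setU A T) in dAT *.
  have degb : #|A| <= #|nbr e2 (b |: (A :|: T)) b|.
    apply/subset_leq_card/subsetP=> z zA; rewrite !inE zA orbT /=.
    apply/s2/s1/cA; rewrite ?inE ?eqxx ?zA ?orbT //.
    by apply: contraNneq bA => ->.
  have degy : #|A| + #|T :\ y| <= #|nbr e2 (b |: (A :|: T)) y|.
    have /eqP <- : #|A :|: (T :\ y)| == #|A| + #|T :\ y|.
      rewrite leq_card_setU; apply: disjointWr dAT; exact: subsetDl.
    apply/subset_leq_card/subsetP=> z; rewrite !inE => /orP[zA | /andP[zy zT]].
      by rewrite zA orbT /= sym2 s2 // s1 // cAT.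
    by rewrite zT !orbT /= s2 // clT // eq_sym.
  by have := cardsD1 y T; rewrite yT; move: cX degb degy a3; clear; lia.
apply/l2/linked_clique => // x y.
rewrite !(setUA [set b]) !(in_setU _ (b |: A)).
move=> /orP[xA | xT] /orP[yA | yT] xy.
- by apply/s2/s1/cA.
- by move: xA; rewrite !inE => /predU1P[-> | xA];
  rewrite ?bT2 // s2 // s1 // cAT.
- move: yA; rewrite sym2 !inE => /predU1P[-> | yA]; rewrite ?bT2 // s2 // s1 //.
  exact: cAT.
- by rewrite s2 // clT.
Qed.

End Paths.

(** * Colour-preserving bijections and small counts *)

(** Fibres over the same colour are matched by their enumerations. The points [x0] and [y0] are
    defaults for [nth], never reached since the indices are in range. *)
Lemma fibre_bij (V V' : finType) (C : finType) (c : V -> C) (c' : V' -> C)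
    (x0 : V) (y0 : V') :
  (forall k, #|[pred x | c x == k]| = #|[pred y | c' y == k]|) ->
  exists2 f : V -> V', bijective f & forall x, c' (f x) = c x.
Proof.
move=> cc.
pose E k := enum [pred x | c x == k]; pose E' k := enum [pred y | c' y == k].
have sE k : size (E k) = size (E' k) by rewrite -!cardE cc.
pose f x := nth y0 (E' (c x)) (index x (E (c x))).
pose g y := nth x0 (E (c' y)) (index y (E' (c' y))).
have ltf x : index x (E (c x)) < size (E' (c x)).
  by rewrite -sE index_mem mem_enum inE.
have ltg y : index y (E' (c' y)) < size (E (c' y)).
  by rewrite sE index_mem mem_enum inE.
have cf x : c' (f x) = c x.
  by have := mem_nth y0 (ltf x); rewrite mem_enum inE => /eqP.
have cg y : c (g y) = c' y.
  by have := mem_nth x0 (ltg y); rewrite mem_enum inE => /eqP.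
exists f => //; exists g => [x | y].
  rewrite /g cf /f index_uniq ?enum_uniq ?ltf // nth_index //.
  by rewrite mem_enum inE.
rewrite /f cg /g index_uniq ?enum_uniq ?ltg // nth_index //.
by rewrite mem_enum inE.
Qed.

Lemma card_sum_pred (T1 T2 : finType) (P : pred (T1 + T2)) :
  #|[pred x | P x]| = #|[pred x | P (inl x)]| + #|[pred x | P (inr x)]|.
Proof. by rewrite -!sum1_card big_sumType. Qed.

Lemma card_pred_const (T : finType) (b : bool) : #|[pred x : T | b]| = b * #|T|.
Proof. by case: b; rewrite ?mul1n ?mul0n ?card0 //; apply: eq_card. Qed.

Lemma card_star_leaves m : #|{: {z : star m | z != star_center m}}| = m.
Proof.
rewrite card_sig (eq_card (B := predC1 (star_center m))) //.
by rewrite cardC1 card_sum !card_ord.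
Qed.

Lemma max_clique (G : sgraph) :
  exists2 K : {set G}, clique K & #|K| = clique_number G.
Proof.
have : 0 < #|[pred A : {set G} | clique A]|.
  apply/card_gt0P; exists set0; rewrite inE; apply/forall_inP=> x.
  by rewrite inE.
by case/(eq_bigmax_cond (fun A : {set G} => #|A|)) => K cK KE; exists K.
Qed.

(** * A clique, its boundary and the heavy vertices *)

Section Graph.
Variable G : sgraph.
Implicit Types (K A B T S : {set G}) (x y z u v : G).

Lemma cliqueP K : reflect {in K &, forall x y, x != y -> adj x y} (clique K).
Proof.
apply: (iffP forall_inP) => [cK x y xK yK | cK x xK].
  by have /forall_inP/(_ y yK)/implyP := cK x xK.
by apply/forall_inP=> y yK; apply/implyP; apply: cK.
Qed.

Lemma degreeE x : degree x = #|nbr adj [set: G] x|.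
Proof. by apply: eq_card => y; rewrite !inE. Qed.

Definition boundary K := [set x in K | [exists y in ~: K, adj x y]].

(** For a maximum clique [K] the bound is n - w, so these are the vertices to be covered. *)
Definition heavy K := [set z : G | #|~: K| < degree z].

Lemma boundary_sub K : boundary K \subset K.
Proof. by apply/subsetP=> x; rewrite inE => /andP[]. Qed.

Lemma interior_nonadj K x y :
  x \in K :\: boundary K -> y \notin K -> adj x y = false.
Proof.
rewrite !inE => /andP[+ xK] yK; rewrite xK /= => nx.
by apply: contraNF nx => xy; apply/exists_inP; exists y; rewrite ?inE.
Qed.

Lemma linked_or_tight K :
  clique K ->
  {in heavy K &, forall u v, u != v -> linked adj setT (heavy K) u v} \/
  [/\ #|~: K| + 2 <= #|K|, heavy K :\: K != set0 &
      {in heavy K :\: K, forall y, degree y = #|~: K|.+1 /\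
         {in boundary K, forall x, adj x y}}].
Proof.
move=> /cliqueP cK; set r := #|~: K|; set S := heavy K.
have [e1 [s1 sym1 irr1 c1 l1]] :=
  degree_closure [set: G] (@adj_sym G) (@adj_irrefl G).
have [clq|nclq] := boolP [forall x in S, forall y in S, (x != y) ==> e1 x y].
  left=> u v uS vS uv; apply/l1/linked_clique => //.
  by move=> x y xS yS xy;
    have /forall_inP/(_ x xS)/forall_inP/(_ y yS)/implyP := clq; apply.
right; pose d1 x := #|nbr e1 [set: G] x|.
have nE : #|K| + r = #|[set: G]| by rewrite cardsT cardsC.
have join x y : x != y -> #|K| + r < d1 x + d1 y -> e1 x y.
  by rewrite nE; apply: c1; rewrite inE.
have notclq : ~ {in S &, forall x y, x != y -> e1 x y}.
  move=> clq; case/negP: nclq; apply/forall_inP=> x xS; apply/forall_inP=> y yS.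
  by apply/implyP; apply: clq.
have dle x : degree x <= d1 x by rewrite degreeE nbr_sub.
have dS x : x \in S -> r < d1 x by rewrite inE => /leq_trans; apply.
have dK x : x \in K -> #|K| <= (d1 x).+1.
  move=> xK; rewrite (cardsD1 x) xK add1n ltnS; apply/subset_leq_card/subsetP.
  by move=> z; rewrite !inE => /andP[zx zK]; rewrite s1 // cK // eq_sym.
have dKout x y : x \in K -> y \notin K -> e1 x y -> #|K| <= d1 x.
  move=> xK yK xy; have -> : #|K| = #|y |: K :\ x|.
    by rewrite cardsU1 !inE (negPf yK) andbF (cardsD1 x K) xK.
  apply/subset_leq_card/subsetP=> z.
  rewrite !inE => /predU1P[-> // | /andP[zx zK]].
  by rewrite s1 // cK // eq_sym.
(* Otherwise two heavy vertices have degree sum at least 2r + 2 > |K| + r, and the closure joins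
   them all. *)
have wr : r + 2 <= #|K|.
  rewrite leqNgt; apply/negP=> wr; apply: notclq => x y xS yS xy.
  by apply: join => //; have := dS x xS; have := dS y yS; move: wr; clear; lia.
(* A closed degree of at least r + 2 would spread: [y] is joined to all of [K], so each vertex of
   [K] reaches degree |K| and is joined to all heavy vertices, which then all have degree at least
   |K| > r and form a clique. *)
have tight y : y \in S :\: K -> d1 y = r.+1.
  rewrite inE => /andP[yK yS].
  apply/eqP; rewrite eqn_leq dS // andbT leqNgt; apply/negP=> dy.
  have yx x : x \in K -> e1 x y.
    move=> xK; apply: join; last by have := dK x xK; move: dy; clear; lia.
    by apply: contraNneq yK => <-.
  have dK' x : x \in K -> #|K| <= d1 x by move=> xK;
    apply: dKout xK yK (yx x xK).
  have KS x z : x \in K -> z \in S -> z \notin K -> e1 x z.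
    move=> xK zS zK; apply: join; last by have := dK' x xK; have := dS z zS;
      clear; lia.
    by apply: contraNneq zK => <-.
  have dT z : z \in S -> z \notin K -> #|K| <= d1 z.
    move=> zS zK; apply/subset_leq_card/subsetP=> x xK.
    by rewrite !inE sym1 KS.
  have dSK z : z \in S -> #|K| <= d1 z.
    by move=> zS; case zK: (z \in K); [apply: dK' | apply: dT; rewrite ?zK].
  apply: notclq => x z xS zS xz; apply: join => //.
  by have := dSK x xS; have := dSK z zS; move: wr; clear; lia.
split=> //.
  apply/negP; rewrite setD_eq0 => /subsetP SK;
    apply: notclq => x y /SK xK /SK yK.
  by move=> xy; rewrite s1 // cK.
move=> y yT; have dy := tight y yT.
move: (yT); rewrite inE => /andP[yK yS].
have degy : degree y = r.+1.
  by apply/eqP; rewrite eqn_leq -{1}dy dle; move: yS; rewrite inE.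
split=> // x; rewrite inE => /andP[xK /exists_inP[z]]; rewrite inE => zK xz.
(* A boundary vertex has closed degree at least |K|, enough to be joined to [y]. The closure adds no
   edge at [y], whose degree was already r + 1, so this is an edge of [G]. *)
have e1xy : e1 x y.
  apply: join; first by apply: contraNneq yK => <-.
  by have := dKout x z xK zK (s1 _ _ xz); rewrite dy; clear; lia.
have sN : nbr adj [set: G] y \subset nbr e1 [set: G] y.
  by apply/subsetP=> t; rewrite !inE; apply: s1.
have /eqP NE : nbr adj [set: G] y == nbr e1 [set: G] y.
  by rewrite eqEcard sN -degreeE degy -dy leqnn.
have : x \in nbr e1 [set: G] y by rewrite !inE sym1.
by rewrite -NE !inE adj_sym.
Qed.

(** As [y] has degree r + 1, with r the number of vertices outside [K], the two inclusions give 2 <=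
    |A| <= r + 1 for the boundary A. Equality at either end determines the neighbourhood of [y]. *)
Lemma nbr_tight K y :
  {in heavy K :\: K, forall z, degree z = #|~: K|.+1 /\
     {in boundary K, forall x, adj x z}} ->
  y \in heavy K :\: K ->
  nbr adj setT y \subset boundary K :|: (~: K :\ y) /\
  boundary K \subset nbr adj setT y.
Proof.
move=> tight yT; move: (yT); rewrite inE => /andP[yK _]; split; last first.
  by apply/subsetP=> x xA; rewrite !inE adj_sym (tight y yT).2.
apply/subsetP=> x; rewrite !inE => yx.
have [xK|xK] := boolP (x \in K); last first.
  by rewrite andbT; apply/orP; right; apply: contraTneq yx => ->;
    rewrite adj_irrefl.
by apply/orP; left => /=; apply/exists_inP; exists y; rewrite ?inE // adj_sym.
Qed.

Lemma linked_tight K :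
  clique K -> #|~: K| + 2 <= #|K| -> heavy K :\: K != set0 ->
  {in heavy K :\: K, forall y, degree y = #|~: K|.+1 /\
     {in boundary K, forall x, adj x y}} ->
  2 < #|boundary K| ->
  ~~ ((#|boundary K| == #|~: K|.+1) && (#|heavy K :\: K| == #|~: K|)) ->
  {in heavy K &, forall u v, u != v -> linked adj setT (heavy K) u v}.
Proof.
move=> /cliqueP cK wr /set0Pn[y0 y0T] tight a3 nexc.
set A := boundary K in tight a3 nexc *;
  set T := heavy K :\: K in y0T tight nexc *.
set r := #|~: K| in wr tight nexc *; pose B := K :\: A.
have sAK : A \subset K := boundary_sub K.
have TK y : y \in T -> y \notin K by rewrite inE => /andP[].
have a_le : #|A| <= r.+1.
  rewrite -(tight y0 y0T).1 degreeE; apply: subset_leq_card.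
  exact: (nbr_tight tight y0T).2.
have cB : #|B| = #|K| - #|A| by rewrite cardsDS.
have /card_gt0P[b0 b0B] : 0 < #|B|.
  by rewrite cB; move: a_le wr; clear; lia.
have BK b : b \in B -> b \in K by rewrite inE => /andP[].
have dAT : [disjoint A & T].
  rewrite -setI_eq0 -subset0; apply/subsetP=> z; rewrite !in_setI.
  by case/andP=> /(subsetP sAK) zK /TK; rewrite zK.
have core b u v : b \in B -> u \in b |: (A :|: T) -> v \in b |: (A :|: T) ->
    u != v -> linked adj (b |: (A :|: ~: K)) (b |: (A :|: T)) u v.
  move=> bB uX vX uv; have bK := BK b bB.
  have bA : b \notin A by move: bB; rewrite inE => /andP[].
  have bT : b \notin T by apply: contraL bK; apply: TK.
  have cbA : {in b |: A &, forall x y, x != y -> adj x y}.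
    move=> x y xA yA; apply: cK; [move: xA | move: yA];
      by rewrite in_setU1 => /predU1P[-> | /(subsetP sAK)].
  have sTK : T \subset ~: K by apply/subsetP=> z /TK; rewrite inE.
  have adjAT : {in A & T, forall x y, adj x y}.
    by move=> x y xA yT; apply: (tight y yT).2.
  (* The ambient set must have at most 2r + 1 vertices. If |A| <= r, all outer vertices fit, and the
     full degree r + 1 of each vertex of [T] counts. If |A| = r + 1, then |T| < r, so [T] alone fits
     and the neighbours in [A] suffice. *)
  have [a_r | r_a] := leqP #|A| r.
    apply: (linked_core (@adj_sym G) (@adj_irrefl G) bA bT dAT a3 cbA adjAT
              _ _ _ uX vX uv (r := r)).
    - by apply/setUS/setUS.
    - rewrite cardsU1; have := leq_card_setU A (~: K) => -[+ _].
      by rewrite -/r; move: a_r; case: (b \notin _); clear => /=; lia.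
    move=> y yT; rewrite -(tight y yT).1 degreeE.
    apply/subset_leq_card/subsetP=> z zN.
    have := subsetP (nbr_tight tight yT).1 z zN.
    move: zN; rewrite in_nbr => /andP[_ yz]; rewrite in_nbr yz andbT.
    rewrite in_setU => /orP[zA | ]; rewrite in_setU1 in_setU.
      by rewrite zA orbT.
    by rewrite in_setD1 => /andP[_ ->]; rewrite !orbT.
  have aE : #|A| = r.+1 by apply/eqP; rewrite eqn_leq a_le.
  have tr : #|T| < r.
    by move: nexc; rewrite aE eqxx /= ltn_neqAle => -> /=;
      apply: subset_leq_card.
  apply: (@linkedS _ _ (b |: (A :|: T))) (subxx _) _;
    first by apply/setUS/setUS.
  apply: (linked_core (@adj_sym G) (@adj_irrefl G) bA bT dAT a3 cbA adjAT
            (subxx _) _ _ uX vX uv (r := r)).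
    rewrite cardsU1; have := leq_card_setU A T => -[+ _].
    by move: aE tr; case: (b \notin _); clear => /=; lia.
  move=> y yT; rewrite -aE; apply/subset_leq_card/subsetP=> x xA.
  by rewrite in_nbr in_setU1 in_setU xA orbT /= adj_sym adjAT.
(* Vertices of [B] have all their neighbours in the clique [K], hence any of them can be inserted
   next to [b]. *)
have BN b z : b \in B -> adj b z -> z \in K.
  by move=> bB; apply: contraTT => zK; rewrite (interior_nonadj bB zK).
have insert b u v (C : {set G}) : b \in B -> C \subset B :\ b ->
    u \in b |: (A :|: T) -> v \in b |: (A :|: T) -> u != v ->
    linked adj (C :|: (b |: (A :|: ~: K))) (C :|: (b |: (A :|: T))) u v.
  move=> bB /subsetP sC uX vX uv.
  apply: (linked_insert_set (b := b)) (core b u v bB uX vX uv) => //.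
  - exact: adj_sym.
  - by rewrite setU11.
  - move=> c /sC; rewrite in_setD1 => /andP[cb /BK cKK].
    by apply: cK => //; [exact: BK | rewrite eq_sym].
  move=> c /sC; rewrite in_setD1 => /andP[cb /BK cKK] z bz zc.
  by apply: cK => //; [exact: BN bz | rewrite eq_sym].
have ABT x : x \in heavy K -> [|| x \in B, x \in A | x \in T].
  move=> xS; have [xB // | xB] := boolP (x \in B).
  move: xB; rewrite !in_setD xS; case xK: (x \in K);
    first by rewrite andbT negbK => ->.
  by rewrite orbT.
move=> u v uS vS uv.
(* Only one vertex of [B] belongs to the core. If both ends lie in [B], a path from [u] to some [x]
   in [A] covers everything but [v], which is then appended. *)
have [/andP[uB vB] | nuv] := boolP ((u \in B) && (v \in B)).
  have /card_gt0P[x xA] : 0 < #|A| by apply: leq_trans a3.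
  have ux : u != x by apply: contraTneq uB => ->; rewrite in_setD xA.
  have [||||s [us sW Ss]] := insert u u x (B :\ u :\ v) uB.
  - exact: subsetDl.
  - exact: setU11.
  - by rewrite in_setU1 in_setU xA orbT.
  - exact: ux.
  have vs : v \notin s.
    apply/negP=> /sW;
      rewrite in_setU in_setD1 eqxx /= in_setU1 eq_sym (negPf uv) /=.
    rewrite in_setU in_setC BK // orbF; apply/negP.
    by move: vB; rewrite in_setD => /andP[].
  exists (s ++ [:: v]); split=> [||z zS]; first 1 last.
  - by move=> z _; rewrite inE.
  - rewrite mem_cat mem_seq1; have [->|zv] := eqVneq z v; first by rewrite orbT.
    rewrite orbF; apply: Ss.
    rewrite in_setU !in_setD1 zv in_setU1 in_setU.
    by case: eqP => //= _; apply: ABT.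
  apply: (upath_cat us (upath1 _ v)).
    apply: cK; [exact: (subsetP sAK) | exact: BK |].
    by apply: contraTneq vB => <-; rewrite in_setD xA.
  by rewrite cat_uniq (upath_uniq us) /= orbF andbT.
(* The representative [b] is the end lying in [B], if there is one, and [b0] otherwise. *)
have [b [bB ub vb]] : exists b, [/\ b \in B, u \in b |: (A :|: T) &
    v \in b |: (A :|: T)].
  have := ABT u uS; have := ABT v vS; move: nuv.
  have [uB | uB] := boolP (u \in B); have [vB | vB] := boolP (v \in B) => //= _.
  - by move=> vX _; exists u; rewrite !in_setU1 eqxx !in_setU vX orbT.
  - by move=> _ uX; exists v; rewrite !in_setU1 eqxx !in_setU uX orbT.
  - by move=> vX uX; exists b0; rewrite !in_setU1 !in_setU uX vX !orbT.
apply: linkedS (insert b u v (B :\ b) bB (subxx _) ub vb uv);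
  first exact: subsetT.
apply/subsetP=> x /ABT; rewrite in_setU in_setD1 in_setU1 in_setU.
by case: eqP => //= _; rewrite orbC.
Qed.

End Graph.

(** * Recognising the extremal graphs by the sizes of their parts *)

Lemma card_ord_pred m (b : bool) : #|[pred i : 'I_m | b]| = b * m.
Proof. by rewrite card_pred_const card_ord. Qed.

Section JoinColour.
Variables (a b : nat) (H : sgraph).

(** Colours name the parts of the join. Once part sizes agree, [fibre_bij] gives the vertex map, and
    adjacency is compared through colours. *)
Definition join_colour
    (x : graph_join (complete a) (graph_union (complete b) H)) : option bool :=
  match x with inl _ => None | inr (inl _) => Some true | inr (inr _) => Some false end.

Lemma card_join_colour k :
  #|[pred x | join_colour x == k]| =
    match k with None => a | Some true => b | Some false => #|H| end.
Proof.
rewrite card_sum_pred card_sum_pred /= !card_ord_pred card_pred_const.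
by case: k => [[]|] /=; rewrite ?mul1n ?mul0n ?addn0.
Qed.

End JoinColour.

(* The parts of [H1xyH2]: the K_2, the K_(w - 2), the vertex x = y, and the
   leaves of the star. *)
Definition H1xyH2_colour n w (p : H1xyH2 n w) : option (option bool) :=
  match p with
  | inl (inl _) => None
  | inl (inr (inl _)) => Some None
  | inl (inr (inr _)) => Some (Some true)
  | inr _ => Some (Some false)
  end.

Lemma card_H1xyH2_colour n w k :
  #|[pred p | @H1xyH2_colour n w p == k]| =
    match k with
    | None => 2 | Some None => w - 2 | Some (Some true) => 1
    | Some (Some false) => n - w - 1 end.
Proof.
rewrite card_sum_pred card_sum_pred card_sum_pred /= !card_ord_pred.
rewrite card_pred_const card_star_leaves.
by case: k => [[[]|]|] /=; rewrite ?mul1n ?mul0n ?addn0.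
Qed.

Section Extremal.
Variables (G : sgraph) (K : {set G}).
Let A := boundary K.

Definition clique_colour x : option bool :=
  if x \in A then None else Some (x \in K).

Lemma card_clique_colour k :
  #|[pred x | clique_colour x == k]| =
    match k with None => #|A| | Some true => #|K :\: A| | Some false => #|~: K| end.
Proof.
case: k => [[]|]; apply: eq_card => x; rewrite [LHS]inE /clique_colour.
- by rewrite in_setD; case: (x \in A) => //=; case: (x \in K).
- rewrite in_setC; have [xA | _] := boolP (x \in A).
    by rewrite (subsetP (boundary_sub K)).
  by case: (x \in K).
by case: (x \in A).
Qed.

Lemma colour_bijection (H : sgraph) :
  0 < #|A| -> #|~: K| = #|H| ->
  exists2 f : G -> graph_join (complete #|A|) (graph_union (complete #|K :\: A|) H),
    bijective f & forall x, join_colour (f x) = clique_colour x.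
Proof.
move=> a0 RH; have /card_gt0P[x0 _] := a0.
apply: fibre_bij x0 (inl (Ordinal a0)) _ => k.
by rewrite card_clique_colour card_join_colour RH.
Qed.

Hypothesis cK : clique K.
Hypothesis tight : {in heavy K :\: K, forall z, degree z = #|~: K|.+1 /\
     {in boundary K, forall x, adj x z}}.

(** All outer vertices are heavy, of degree r + 1 = |A|, and adjacent to all of [A]; so their
    neighbourhood is [A] and the outside is edgeless. *)
Lemma tight_isomorphic :
  #|A| = #|~: K|.+1 -> #|heavy K :\: K| = #|~: K| ->
  isomorphic G (graph_join (complete #|A|)
    (graph_union (complete #|K :\: A|) (edgeless #|~: K|))).
Proof.
move=> aE tE; have /cliqueP cKK := cK.
have sAK := subsetP (boundary_sub K).
have TE : heavy K :\: K = ~: K.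
  by apply/eqP; rewrite eqEcard tE leqnn andbT; apply/subsetP=> z;
    rewrite !inE => /andP[].
have NE y : y \notin K -> nbr adj setT y = A.
  move=> yK; have yT : y \in heavy K :\: K by rewrite TE inE.
  apply/esym/eqP; rewrite eqEcard (nbr_tight tight yT).2.
  by rewrite -degreeE (tight yT).1 aE leqnn.
have outA z : z \notin K -> (z \in A) = false.
  by move=> zK; apply: contraNF zK; apply: sAK.
have adjR x y : y \notin K -> adj x y = (x \in A).
  by move=> yK; rewrite adj_sym -(NE y yK) in_nbr inE.
have a0 : 0 < #|A| by rewrite aE.
have [f bf cf] := colour_bijection (H := edgeless #|~: K|) a0 (esym (card_ord _)).
exists f => // x y;
  have fxy : (f x == f y) = (x == y) := inj_eq (bij_inj bf) x y.
have -> : adj x y = (x != y) && match clique_colour x, clique_colour y with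
    | None, _ | _, None => true | Some c, Some d => c && d end.
  rewrite /clique_colour; have [-> | xy] := eqVneq x y;
    first by rewrite adj_irrefl.
  have [xK | xK] := boolP (x \in K); last first.
    by rewrite adj_sym adjR // (outA x) //; case: (y \in A).
  have [yK | yK] := boolP (y \in K); last first.
    by rewrite adjR // (outA y) //; case: (x \in A).
  by rewrite cKK //; case: (x \in A); case: (y \in A).
rewrite -!cf -fxy.
case: (f x) (f y) => [i | [i | i]] [j | [j | j]] //=; rewrite ?andbT ?andbF //.
Qed.

(** With |A| = 2 the upper bound in [nbr_tight] has r + 1 elements, so a heavy outer vertex [y0] is
    adjacent to [A] and to every other outer vertex: it is the merged vertex of [H1xyH2]. The upper
    containment holds because no edge joins [K :\: A] to the outside. *)
Lemma tight_in_calH n w :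
  #|K| = w -> n - w = #|~: K| -> heavy K :\: K != set0 -> #|A| = 2 ->
  in_calH n w G.
Proof.
move=> wE nE /set0Pn[y0 y0T] a2; have /cliqueP cKK := cK.
have sAK := subsetP (boundary_sub K).
have bE : #|K :\: A| = w - 2 by rewrite cardsDS ?boundary_sub // wE a2.
have [y0K y0S] : y0 \notin K /\ y0 \in heavy K by move: y0T;
  rewrite inE => /andP[].
have RE : #|~: K :\ y0| = n - w - 1.
  by rewrite nE (cardsD1 y0 (~: K)) inE y0K add1n subn1.
have NE : nbr adj setT y0 = A :|: (~: K :\ y0).
  apply/eqP; rewrite eqEcard (nbr_tight tight y0T).1 -degreeE (tight y0T).1.
  rewrite (leq_trans (leq_card_setU _ _).1) // a2 (cardsD1 y0 (~: K)) inE y0K.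
  by [].
split; last first.
  have a0 : 0 < #|A| by rewrite a2.
  have [f bf cf] := colour_bijection (H := complete (n - w))
    a0 (etrans (esym nE) (esym (card_ord _))).
  move: f bf cf; rewrite a2 bE => f bf cf.
  exists f => // x y xy; have : f x != f y.
    by rewrite (bij_eq bf); apply: contraTneq xy => ->; rewrite adj_irrefl.
  have : match clique_colour x, clique_colour y with
      | Some c, Some d => c == d | _, _ => true end.
    rewrite /clique_colour.
    have [//|xA] := boolP (x \in A); have [//|yA] := boolP (y \in A).
    apply/eqP; case xK: (x \in K); case yK: (y \in K) => //.
      by rewrite (@interior_nonadj G K) ?inE ?yK // in xy;
        rewrite !inE in xA *; rewrite xA xK.
    by rewrite adj_sym (@interior_nonadj G K) ?inE ?xK // in xy;
      rewrite !inE in yA *; rewrite yA yK.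
  by rewrite -!cf; case: (f x) (f y) => [i | [i | i]] [j | [j | j]].
(* Mirrors [H1xyH2_colour]: [A] is the K_2, [K :\: A] the K_(w - 2), [y0] the merged vertex and the
   other outer vertices the leaves. *)
pose c' x : option (option bool) :=
  if x \in A then None else if x \in K then Some None else Some (Some (x == y0)).
have outA z : z \notin K -> (z \in A) = false.
  by move=> zK; apply: contraNF zK; apply: sAK.
have [f bf cf] : exists2 f : H1xyH2 n w -> G,
    bijective f & forall p, c' (f p) = H1xyH2_colour p.
  apply: (fibre_bij (inl (inl ord0)) y0) => k.
  rewrite card_H1xyH2_colour.
  have -> : #|[pred y | c' y == k]| = match k with
      | None => #|A| | Some None => #|K :\: A| | Some (Some true) => #|[set y0]|
      | Some (Some false) => #|~: K :\ y0| end.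
    case: k => [[[]|]|]; apply: eq_card => x; rewrite [LHS]inE /c'.
    - rewrite in_set1; have [-> | xy] := eqVneq x y0.
        by rewrite (negPf y0K) outA.
      by case: (x \in A) => //; case: (x \in K).
    - rewrite in_setD1 in_setC; have [xK | xK] := boolP (x \in K).
        by rewrite andbF; case: (x \in A).
      by rewrite outA //; case: (x == y0).
    - by rewrite in_setD; case: (x \in A) => //=; case: (x \in K).
    by case: (x \in A) => //; case: (x \in K).
  by case: k => [[[]|]|]; rewrite ?cards1.
exists f => // p q pq.
have fpq : f p != f q.
  by rewrite (bij_eq bf); apply: contraTneq pq => ->; rewrite adj_irrefl.
have edge x y : c' x = None -> x != y -> c' y != Some (Some false) -> adj x y.
  rewrite /c'; case: ifP => [xA _ xy | _]; last by case: (x \in K).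
  case: ifP => [yA _ | _]; first by rewrite cKK ?sAK.
  case: ifP => [yK _ | _]; first by apply: cKK => //; apply: sAK.
  by have [-> _ | _] := eqVneq y y0; [apply: (tight y0T).2 | rewrite eqxx].
have edgeB x y : c' x = Some None -> x != y -> c' y = Some None -> adj x y.
  rewrite /c'; case: ifP => // _; case: ifP => // xK _ xy.
  by case: ifP => // _; case: ifP => // yK _; rewrite cKK.
have edgeR x y : c' x = Some (Some true) -> c' y = Some (Some false) -> adj x y.
  rewrite /c'; case: ifP => // _; case: ifP => // _ [] /eqP ->.
  case: ifP => // _; case: ifP => // yK [] yy0.
  have : y \in nbr adj setT y0 by rewrite NE in_setU in_setD1 in_setC yK yy0 orbT.
  by rewrite in_nbr inE.
have qp : f q != f p by rewrite eq_sym.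
have := cf p; have := cf q.
case: p q pq fpq qp => [[i | [i | i]] | i] [[j | [j | j]] | j] // pq fpq qp cq cp;
  try by [apply: edge => //; rewrite cq
     | rewrite adj_sym; apply: edge => //; rewrite cp
     | apply: edgeB | apply: edgeR | rewrite adj_sym; apply: edgeR].
(* What remains are non-edges of [H1xyH2]: the merged vertex with itself, then two leaves. *)
- by move: pq; rewrite /= /complete_adj (ord1 i) (ord1 j).
- by case: i j pq {fpq qp cq cp} => [[i | i] iN] [[j | j] jN] //=;
    move: iN jN; rewrite /star_center ?(ord1 i) ?(ord1 j) ?eqxx.
Qed.

End Extremal.

(** * Assembling the cases *)

Theorem theorem1p6 (G : sgraph) (n w : nat) (u v : G) :
  #|G| = n -> clique_number G = w ->
  u != v -> n - w + 1 <= degree u -> n - w + 1 <= degree v ->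
  (exists p : seq G, path_between u v p /\
     forall z : G, n - w + 1 <= degree z -> z \in u :: p)
  \/ (n + 2 <= 2 * w /\ w <= n - 1 /\
      (isomorphic G
         (graph_join (complete (n - w + 1))
            (graph_union (complete (2 * w - n - 1)) (edgeless (n - w))))
       \/ in_calH n w G)).
Proof.
move=> nE wE uv du dv.
have [K cK Kw] := max_clique G; rewrite wE in Kw.
have wr : w + #|~: K| = n by rewrite -Kw -nE cardsC.
have rE : n - w = #|~: K| by rewrite -wr addKn.
have heavyE z : (n - w + 1 <= degree z) = (z \in heavy K).
  by rewrite rE addn1 inE.
rewrite !heavyE in du dv.
have to_path : {in heavy K &, forall u v, u != v -> linked adj setT (heavy K) u v} ->
    exists p : seq G, path_between u v p /\
      forall z : G, n - w + 1 <= degree z -> z \in u :: p.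
  move=> /(_ u v du dv uv)[[|a p] [us _ Ss]] //.
  have /and4P[/eqP au ep lp ua] := us; rewrite au in ep lp ua Ss.
  by exists p; split=> [|z]; [apply/and3P | rewrite heavyE => /Ss].
have [/to_path | [Kr T0 tight]] := linked_or_tight cK; first by left.
have /set0Pn[y0 y0T] := T0; have [dy0 _] := tight y0 y0T.
have r0 : 0 < #|~: K|.
  by apply/card_gt0P; exists y0; move: y0T; rewrite !in_setD in_setC => /andP[].
have [NA AN] := nbr_tight tight y0T.
(* The r + 1 neighbours of [y0] lie in the boundary or among the r - 1 other outer vertices. *)
have a2 : 2 <= #|boundary K|.
  have := subset_leq_card NA; rewrite -degreeE dy0.
  have yK : y0 \in ~: K by move: y0T; rewrite in_setD in_setC => /andP[].
  have := cardsD1 y0 (~: K);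
    have := (leq_card_setU (boundary K) (~: K :\ y0)).1.
  by rewrite yK; clear; lia.
have [a3 | a_le2] := ltnP 2 #|boundary K|; last first.
  right; split; first by move: Kr; rewrite Kw -wr; clear; lia.
  split; first by rewrite -wr; move: r0; clear; lia.
  right; apply: (tight_in_calH cK tight Kw rE T0).
  by apply/eqP; rewrite eqn_leq a_le2.
have [/andP[/eqP aE /eqP tE] | nexc] :=
  boolP ((#|boundary K| == #|~: K|.+1) && (#|heavy K :\: K| == #|~: K|)).
  right; split; first by move: Kr; rewrite Kw -wr; clear; lia.
  split; first by rewrite -wr; move: r0; clear; lia.
  left; have := tight_isomorphic cK tight aE tE.
  rewrite cardsDS ?boundary_sub // aE Kw rE addn1.
  (* Both sides are the size of [K :\: boundary K], as n = w + r. *)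
  suff -> : 2 * w - n - 1 = w - #|~: K|.+1 by [].
  by rewrite -wr; clear; lia.
by left; apply/to_path/linked_tight.
Qed.
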